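(* Let $X$ be a real Banach space. Then for every $\varepsilon>0$ there is a $\delta>0$ such that for every $p_0\in\mathrm{Sem}(X)$ with $\|p_0\|=1$ and every $x_0\in S_X$ with $p_0(x_0)>1-\delta$, there exist $p\in\mathrm{Sem}(X)$ with $\|p\|=1$ and $x\in S_X$ such that $$p(x)=1=\|p\|,\qquad \|x-x_0\|<\varepsilon,\qquad\text{and}\qquad \|p-p_0\|_\infty=\sup_{z\in S_X}|p(z)-p_0(z)|<\varepsilon.$$
   Context: $S_X$ is the unit sphere of $X$. $\mathrm{Sem}(X)$ is the set of all continuous seminorms on $X$. For $p\in\mathrm{Sem}(X)$, $\|p\|=\sup_{z\in S_X}p(z)$ (this coincides with the smallest Lipschitz constant of $p$). *)

(* Defs.v *)
From HB Require Import structures.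
From mathcomp Require Import all_boot all_order all_algebra.
From mathcomp Require Import all_classical all_reals all_analysis.

Set Implicit Arguments.
Unset Strict Implicit.
Unset Printing Implicit Defensive.

Import Order.TTheory GRing.Theory Num.Theory.
Import numFieldNormedType.Exports.

Local Open Scope classical_set_scope.
Local Open Scope ring_scope.

Definition unit_sphere (R : realType) (X : normedModType R) : set X :=
  [set z | `|z| = 1].
Arguments unit_sphere {R} X _.

(* Nonnegativity of a seminorm follows from the first two conditions. *)
Definition Sem (R : realType) (X : normedModType R) : set (X -> R) :=
  [set p | [/\ forall x y, p (x + y) <= p x + p y,
               forall (a : R) x, p (a *: x) = `|a| * p x
             & continuous p]].
Arguments Sem {R} X _.

(* [sup] is the real-valued supremum, with junk value 0 on sets that are empty
   or unbounded above. A continuous seminorm is bounded on the unit sphere, so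
   for [p] and [p - p0] with [p, p0] in [Sem X] the junk value can only occur
   when the sphere is empty, i.e. when X is trivial, where it yields 0. *)
Definition sem_norm (R : realType) (X : normedModType R) (p : X -> R) : R :=
  sup [set p z | z in unit_sphere X].

Definition sup_norm (R : realType) (X : normedModType R) (f : X -> R) : R :=
  sup [set `|f z| | z in unit_sphere X].

(* Main.v *)
Require Import Defs.
From HB Require Import structures.
From mathcomp Require Import all_boot all_order all_algebra.
From mathcomp Require Import all_classical all_reals all_analysis.
From mathcomp Require Import ring lra.

Set Implicit Arguments.
Unset Strict Implicit.
Unset Printing Implicit Defensive.

Import Order.TTheory GRing.Theory Num.Theory.
Import numFieldNormedType.Exports.

Local Open Scope classical_set_scope.
Local Open Scope ring_scope.

(** Ekeland's principle for [p0] on the closed unit ball, with slope [k], yields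
    a point [x] close to [x0] such that [p0 u <= p0 x + k * `|u - x|] on the
    ball; a rescaling shows that [x] lies on the sphere. With
    [r = (p0 + k * `|.|) / (p0 x - k)], this inequality gives
    [1 <= `|x - w| + r w] for every [w]. So the largest seminorm [p] below both
    the norm and [r], namely their infimal convolution, satisfies [p x = 1],
    while [p0 <= p <= r] makes it close to [p0]. *)

(** The sets [S x] are closed and define a transitive relation. Choosing an almost maximal point of
    the current set at each stage gives a Cauchy sequence, whose limit lies in all of these sets. *)
Lemma ekeland_max (R : realType) (X : completeNormedModType R)
    (f : X -> R) (A : set X) (k M : R) (x0 : X) :
  closed A -> continuous f -> 0 < k -> (forall u, A u -> f u <= M) -> A x0 ->
  exists x, [/\ A x, f x0 + k * `|x - x0| <= f x &
                forall u, A u -> f u <= f x + k * `|u - x|].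
Proof.
move=> clA cf k0 fM Ax0.
pose S x := [set u | A u /\ f x + k * `|u - x| <= f u].
have S_refl x : A x -> S x x.
  by move=> Ax; split=> //; rewrite subrr normr0 mulr0 addr0.
have S_trans x y z : S x y -> S y z -> S x z.
  move=> [_ xy] [Az yz]; split=> //.
  have := ler_distD y z x; rewrite -(ler_pM2l k0) mulrDr; lra.
have S_closed x : closed (S x).
  have -> : S x = A `&` (fun u => f u - k * `|u - x|) @^-1` [set t | f x <= t].
    by apply/seteqP; split=> u /=; rewrite /S /= lerBrDr.
  apply: closedI => //; apply: closed_comp; last exact: closed_ge.
  move=> u _; apply: cvgB; first exact: cf.
  apply: cvgMr; apply: cvg_norm; apply: cvgB; [exact: cvg_id | exact: cvg_cst].
(* The index carries the tolerance. The premise [A nx.2] sits under the existential so that [choice]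
   yields a total function. *)
have next (nx : nat * X) : exists y, A nx.2 -> S nx.2 y /\
    forall u, S nx.2 u -> f u <= f y + nx.1.+1%:R^-1.
  case: nx => n x /=; have [Ax|nAx] := pselect (A x); last by exists x.
  have hsup : has_sup (f @` S x).
    split; first by exists (f x), x => //; exact: S_refl.
    by exists M => _ [u [Au _] <-]; exact: fM.
  have n0 : 0 < n.+1%:R^-1 :> R by rewrite invr_gt0 ltr0n.
  have [_ [y Sy <-] fy] := sup_adherent n0 hsup.
  exists y => _; split=> // u Su.
  have : f u <= sup (f @` S x) by apply: sup_upper_bound => //; exists u.
  by move=> /le_trans; apply; rewrite -lerBlDr ltW.
have [g gP] := choice next.
pose xs := fix xs n := if n is m.+1 then g (m, xs m) else x0.
have Axs n : A (xs n).
  by elim: n => [//|n IH] /=; have [[]] := gP (n, xs n) IH.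
have S_xs n m : (n <= m)%N -> S (xs n) (xs m).
  move=> /subnK <-; elim: (m - n)%N => [|d IH]; first exact: S_refl.
  by apply: S_trans IH _; rewrite addSn; have [] := gP (d + n, xs (d + n))%N (Axs _).
(* Along [xs] the values of [f] increase and are bounded by [M], and [k] times a distance is at most
   the gain in [f]; so a gap below [k * e] to the supremum forces distances below [e]. *)
have cxs : cvg (xs @ \oo).
  apply/cauchy_cvgP/cauchy_exP => e e0.
  have hsup : has_sup (range (f \o xs)).
    split; first by exists (f x0), 0%N.
    by exists M => _ [n _ <-]; exact: fM.
  have [_ [N _ <-] fN] := sup_adherent (mulr_gt0 k0 e0) hsup.
  exists (xs N); exists N => // m Nm; rewrite /= -ball_normE /=.
  have : f (xs m) <= sup (range (f \o xs)) by apply: sup_upper_bound => //; exists m.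
  rewrite /= in fN; have [_] := S_xs _ _ Nm; rewrite distrC -(ltr_pM2l k0); lra.
set x := lim (xs @ \oo).
have Sx n : S (xs n) x.
  apply: (closed_cvg (S (xs n)) (S_closed (xs n)) _ _ cxs).
  by exists n => // m; exact: S_xs.
exists x; split; [by case: (Sx 0%N) | by case: (Sx 0%N) |].
(* A violating [u] would lie in every [S (xs n)], so [f u] would exceed [f x] by at most
   [n.+1%:R^-1] for every [n]. *)
move=> u Au; rewrite leNgt; apply/negP => lt_u.
have Su : S x u by split=> //; exact: ltW.
have /ltr_add_invr[n] : f x < f u.
  by apply: le_lt_trans lt_u; rewrite lerDl mulr_ge0// ltW.
apply/negP; rewrite -leNgt.
have [_ /(_ u (S_trans _ _ _ (Sx n) Su)) /= fu] := gP (n, xs n) (Axs n).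
apply: le_trans fu _; rewrite lerD2r.
have [_] := Sx n.+1; apply: le_trans.
by rewrite lerDl mulr_ge0// ltW.
Qed.

Section Seminorms.
Variables (R : realType) (X : normedModType R).
Implicit Types (p r : X -> R) (x z w : X).

Lemma sem0 p : Sem X p -> p 0 = 0.
Proof. by move=> [_ pZ _]; rewrite -(scale0r 0) pZ normr0 mul0r. Qed.

Lemma sem_ge0 p z : Sem X p -> 0 <= p z.
Proof.
move=> Sp; have [pD pZ _] := Sp.
have := pD z (- z); rewrite subrr sem0// -scaleN1r pZ normrN1; lra.
Qed.

(* The junk value 0 of [sup] is excluded by the hypothesis on [sem_norm]. *)
Lemma sem_le_norm p : Sem X p -> sem_norm p = 1 -> forall z, p z <= `|z|.
Proof.
move=> Sp p1 z; have [_ pZ _] := Sp.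
have [->|z0] := eqVneq z 0; first by rewrite sem0// normr0.
have nz : 0 < `|z| by rewrite normr_gt0.
have hsup : has_sup [set p z | z in unit_sphere X].
  apply: contrapT => /sup_out; rewrite -/(sem_norm p) p1 => /eqP.
  by rewrite oner_eq0.
have : p (`|z|^-1 *: z) <= 1.
  rewrite -p1; apply: sup_upper_bound => //; exists (`|z|^-1 *: z) => //.
  by rewrite /unit_sphere /= normrZ normfV normr_id mulVf ?gt_eqF.
by rewrite pZ normfV normr_id mulrC ler_pdivrMr// mul1r.
Qed.

(** Subadditivity and domination by the norm make [p] 1-Lipschitz, hence continuous. *)
Lemma sem_of_le_norm p :
  (forall x y, p (x + y) <= p x + p y) ->
  (forall (a : R) x, p (a *: x) = `|a| * p x) ->
  (forall z, p z <= `|z|) -> Sem X p.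
Proof.
move=> pD pZ pn; split=> // x; apply/cvgrPdist_lt => e e0.
near=> y; apply: le_lt_trans (_ : `|x - y| < e); last first.
  by near: y; apply: cvgr_dist_lt.
have pB u v : p u - p v <= `|u - v|.
  by rewrite lerBlDr; apply: le_trans (lerD (pn _) (lexx _)); rewrite -{1}(subrK v u).
by rewrite ler_norml lerNl opprB pB distrC pB.
Unshelve. all: by end_near. Qed.

(** For a seminorm [r] the range is bounded below by 0, so [inf] is a true infimum. *)
Definition norm_infconv r z : R := inf (range (fun w => `|z - w| + r w)).

Section InfConv.
Variable r : X -> R.
Hypothesis Sr : Sem X r.

Lemma norm_infconv_le z w : norm_infconv r z <= `|z - w| + r w.
Proof.
apply: ge_inf; last by exists w.
by exists 0 => _ [v _ <-]; rewrite addr_ge0// sem_ge0.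
Qed.

Lemma le_norm_infconv z t :
  (forall w, t <= `|z - w| + r w) -> t <= norm_infconv r z.
Proof.
move=> tle; apply: lb_le_inf; first by exists (`|z - 0| + r 0), 0.
by move=> _ [w _ <-].
Qed.

Lemma norm_infconv_le_norm z : norm_infconv r z <= `|z|.
Proof. by have := norm_infconv_le z 0; rewrite subr0 sem0// addr0. Qed.

Lemma norm_infconv_ler z : norm_infconv r z <= r z.
Proof. by have := norm_infconv_le z z; rewrite subrr normr0 add0r. Qed.

Lemma norm_infconv_sem : Sem X (norm_infconv r).
Proof.
have [rD rZ _] := Sr.
apply: sem_of_le_norm norm_infconv_le_norm => [x y|a x].
- rewrite -lerBlDr; apply: le_norm_infconv => u.
  rewrite lerBlDr -lerBlDl; apply: le_norm_infconv => v.
  rewrite lerBlDl; apply: le_trans (norm_infconv_le _ (u + v)) _.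
  have := rD u v; have := ler_normD (x - u) (y - v).
  rewrite opprD addrACA; lra.
(* Only this inequality needs proof: the reverse one follows by applying it to [a^-1] at
   [a *: x]. *)
- have leZ b y : norm_infconv r (b *: y) <= `|b| * norm_infconv r y.
    have [->|b0] := eqVneq b 0.
      by rewrite scale0r normr0 mul0r -[leRHS](@normr0 _ X) norm_infconv_le_norm.
    have nb : 0 < `|b| by rewrite normr_gt0.
    rewrite -ler_pdivrMl//; apply: le_norm_infconv => w.
    rewrite ler_pdivrMl// mulrDr -rZ -normrZ scalerBr.
    exact: norm_infconv_le.
  apply/eqP; rewrite eq_le leZ /=.
  have [->|a0] := eqVneq a 0.
    rewrite normr0 mul0r; apply: le_norm_infconv => w.
    by rewrite addr_ge0// sem_ge0.
  have na : 0 < `|a| by rewrite normr_gt0.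
  rewrite -ler_pdivlMl//.
  by have := leZ a^-1 (a *: x); rewrite scalerA mulVf// scale1r normfV.
Qed.

End InfConv.

Lemma sem_perturb p (k c : R) :
  Sem X p -> 0 <= k -> 0 <= c -> Sem X (fun z => c * (p z + k * `|z|)).
Proof.
move=> [pD pZ pc] k0 c0; split=> [x y|a x|x].
- rewrite -mulrDr ler_wpM2l// addrACA -mulrDr lerD// ler_wpM2l//.
  exact: ler_normD.
- by rewrite pZ normrZ; ring.
- apply: cvgMr; apply: cvgD; first exact: pc.
  by apply: cvgMr; apply: cvg_norm; exact: cvg_id.
Qed.

Lemma almost_max_on_sphere p x (k : R) :
  Sem X p -> k < p x -> 0 <= k -> `|x| <= 1 ->
  (forall u, `|u| <= 1 -> p u <= p x + k * `|u - x|) -> `|x| = 1.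
Proof.
move=> Sp kx k0 x1 xmax; have [_ pZ _] := Sp.
have x0 : x != 0.
  by apply: contraTneq kx => ->; rewrite sem0// -leNgt.
have nx : 0 < `|x| by rewrite normr_gt0.
have inv1 : 1 <= `|x|^-1 by rewrite -invr1 lef_pV2// posrE.
have := xmax (`|x|^-1 *: x).
rewrite normrZ normfV normr_id mulVf ?gt_eqF// => /(_ (lexx _)).
have -> : `|x|^-1 *: x - x = (`|x|^-1 - 1) *: x by rewrite scalerBl scale1r.
rewrite normrZ pZ normfV normr_id.
rewrite ger0_norm ?subr_ge0// mulrBl mulVf ?gt_eqF// mul1r => h.
apply/eqP; rewrite eq_le x1 /= leNgt; apply/negP => lt1.
have : (p x - k * `|x|) * (1 - `|x|) <= 0.
  have := ler_wpM2l (ltW nx) h.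
  rewrite mulrA mulfV ?gt_eqF// mul1r; lra.
apply/negP; rewrite -ltNge mulr_gt0 ?subr_gt0//.
by apply: le_lt_trans kx; rewrite ler_piMr.
Qed.

(** With [s =]|x - w|[in](0, 1)[, test the hypothesis at]u = s^-1 *: (x -
    w)[and multiply by]s[: the left side is]p (x - w) >= p x - p w[, and]s * [|u - x|] is the norm
    of [(1 - s) *: x - w]. *)
Lemma almost_max_support p x (k : R) w :
  Sem X p -> 0 <= k <= p x -> `|x| = 1 ->
  (forall u, `|u| <= 1 -> p u <= p x + k * `|u - x|) ->
  (p x - k) * (1 - `|x - w|) <= p w + k * `|w|.
Proof.
move=> Sp /andP[k0 kx] x1 xmax; have [pD pZ _] := Sp.
have pw0 := sem_ge0 w Sp.
have kw0 : 0 <= k * `|w| by rewrite mulr_ge0.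
have [s1|s1] := leP 1 `|x - w|.
  apply: (@le_trans _ _ 0); last exact: addr_ge0.
  by rewrite mulr_ge0_le0 ?subr_ge0 ?subr_le0.
have [/eqP|s0] := eqVneq `|x - w| 0.
  by rewrite normr_eq0 subr_eq0 => /eqP <-; rewrite subrr normr0 x1; lra.
have {}s0 : 0 < `|x - w| by rewrite lt_neqAle eq_sym s0 normr_ge0.
set s := `|x - w| in s0 s1 *.
have := xmax (s^-1 *: (x - w)).
rewrite normrZ normfV normr_id mulVf ?gt_eqF// => /(_ (lexx _)).
rewrite pZ ger0_norm ?invr_ge0 ?(ltW s0)// => /(ler_wpM2l (ltW s0)).
rewrite mulrA mulfV ?gt_eqF// mul1r mulrDr mulrCA => h.
have : s * `|s^-1 *: (x - w) - x| <= (1 - s) + `|w|.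
  rewrite -{1}(ger0_norm (ltW s0)) -normrZ scalerBr scalerA mulfV ?gt_eqF// scale1r.
  rewrite addrAC -{1}(scale1r x) -scalerBl.
  apply: le_trans (ler_normB _ _) _.
  by rewrite normrZ x1 mulr1 ger0_norm// subr_ge0 ltW.
move=> /(ler_wpM2l k0).
have := pD (x - w) w; rewrite subrK; lra.
Qed.

End Seminorms.

Theorem proposition3p4 (R : realType) (X : completeNormedModType R) :
  forall eps : R, 0 < eps ->
  exists delta : R, 0 < delta /\
  forall (p0 : X -> R) (x0 : X),
    Sem X p0 -> sem_norm p0 = 1 ->
    unit_sphere X x0 -> p0 x0 > 1 - delta ->
    exists (p : X -> R) (x : X),
      [/\ Sem X p, sem_norm p = 1 & unit_sphere X x] /\
      [/\ p x = 1, `|x - x0| < eps & sup_norm (fun z => p z - p0 z) < eps].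
Proof.
move=> eps eps0.
have [e [e0 e1 ee]] : exists e : R, [/\ 0 < e, e <= 1 & e <= eps].
  by exists (Num.min eps 1); rewrite lt_min eps0 ltr01 !ge_min !lexx orbT.
pose k := e / 8; have k0 : 0 < k by rewrite /k; lra.
exists (k * e / 2); split=> [|p0 x0 Sp0 np0 x01 px0].
  by rewrite !mulr_gt0// invr_gt0.
have p0n := sem_le_norm Sp0 np0.
have [p0D p0Z p0c] := Sp0.
have ke : k * e <= k by rewrite ler_piMr// ltW.
have [x [x1 x_far xmax]] :
    exists x, [/\ `|x| <= 1, p0 x0 + k * `|x - x0| <= p0 x &
      forall u, `|u| <= 1 -> p0 u <= p0 x + k * `|u - x|].
  apply: (@ekeland_max _ _ p0 [set u | `|u| <= 1] k 1) => //.
  - apply: (@closed_comp _ _ (fun u : X => `|u|) [set t | t <= 1]); last exact: closed_le.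
    by move=> u _; apply: cvg_norm; exact: cvg_id.
  - by move=> u; apply: le_trans (p0n u).
  - by rewrite /= x01.
have kd0 : 0 <= k * `|x - x0| by rewrite mulr_ge0// ltW.
have k8 : k = e / 8 by [].
have kx : k < p0 x by lra.
have nx : `|x| = 1 by apply: almost_max_on_sphere xmax => //; exact: ltW.
pose c := p0 x - k; have c0 : 0 < c by rewrite subr_gt0.
have c34 : 3 / 4 <= c by rewrite /c; lra.
pose r z := c^-1 * (p0 z + k * `|z|).
have Sr : Sem X r by apply: sem_perturb => //; rewrite ?invr_ge0; exact: ltW.
pose p := norm_infconv r.
have Sp : Sem X p by exact: norm_infconv_sem.
have pn z : p z <= `|z| by exact: norm_infconv_le_norm.
have px : p x = 1.
  apply/eqP; rewrite eq_le -{1}nx pn /=; apply: le_norm_infconv => w.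
  rewrite -lerBlDl ler_pdivlMl//; apply: almost_max_support => //.
  by rewrite !ltW.
(* Here [c <= 1], so [p0 <= r]; also [p0] is below the norm, and subadditivity passes both bounds to
   the infimal convolution. *)
have p0p z : p0 z <= p z.
  apply: le_norm_infconv => w.
  have := p0D (z - w) w; rewrite subrK => /le_trans; apply.
  apply: lerD; first exact: p0n.
  have p0w := sem_ge0 w Sp0.
  rewrite ler_pdivlMl//; apply: (@le_trans _ _ (p0 w)).
    rewrite ler_piMl// /c; have := p0n x; lra.
  by rewrite lerDl mulr_ge0// ltW.
exists p, x; split; split=> //.
- apply/eqP; rewrite eq_le; apply/andP; split.
    by apply: ge_sup => [|_ [z /= z1 <-]]; [exists (p x), x | rewrite -z1].
  rewrite -[leLHS]px; apply: sup_upper_bound; last by exists x.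
  split; first by exists (p x), x.
  by exists 1 => _ [z /= z1 <-]; rewrite -z1.
- apply: lt_le_trans ee; rewrite -(ltr_pM2l k0).
  have := p0n x; rewrite nx; nra.
(* On the sphere [p <= r] reduces the claim to [(1 - c) * p0 z + k <= c * e / 2]: the left side is
   at most [3 * e / 16 + e / 8], the right side at least [3 * e / 8]. *)
- apply: le_lt_trans (_ : e / 2 < eps); last by lra.
  apply: ge_sup => [|_ [z /= z1 <-]]; first by exists `|p x0 - p0 x0|, x0.
  rewrite ger0_norm ?subr_ge0// lerBlDr.
  apply: le_trans (norm_infconv_ler Sr z) _.
  have := p0n z; have := sem_ge0 z Sp0; rewrite z1 => p0z0 p0z1.
  rewrite ler_pdivrMl// z1 mulr1 mulrDr.
  have : 1 - e * 3 / 16 <= c by rewrite /c; lra.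
  nra.
Qed.
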